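(* Let $t$ be a caterpillar tree on $n$ vertices with vertex degrees $k_1,\dots,k_n$. Then $$D_{min}^{t} = n-1+\sum_{i=1}^n \left\lfloor \frac{1}{4}(k_i-1)^2\right\rfloor = \sum_{i=1}^n \left\lfloor \frac{1}{4}(k_i+1)^2\right\rfloor - (n-1) = \frac{1}{4}\left(n\langle k^2\rangle + q\right),$$ where $\langle k^2\rangle=\frac1n\sum_{i=1}^n k_i^2$ and $q=\sum_{i=1}^n (k_i\bmod 2)$ is the number of vertices of odd degree.
   Context: A caterpillar tree is a tree such that removing all its leaves leaves a path (a linear tree, possibly a single vertex or empty). A linear arrangement of a tree on $n$ vertices is a bijection $\pi$ from its vertex set to $\{1,\dots,n\}$; $D(\pi)=\sum_{\{u,v\}\in E}|\pi(u)-\pi(v)|$, and $D_{min}^t$ is the minimum of $D(\pi)$ over all linear arrangements of $t$. *)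

(* Defs.v *)
From mathcomp Require Import all_boot all_order all_algebra.

Set Implicit Arguments.
Unset Strict Implicit.
Unset Printing Implicit Defensive.

Import Order.TTheory GRing.Theory Num.Theory.

Section Graphs.
Variables (T : finType) (e : rel T).

Definition simple_graph : Prop := symmetric e /\ irreflexive e.

(* [ucycle] requires distinct vertices; those of size 2 are the back-and-forth
   walks along one edge, which are not graph cycles. *)
Definition acyclic : Prop := forall c : seq T, 2 < size c -> ~ ucycle e c.

Definition connected_graph : Prop := 0 < #|T| /\ forall u v : T, connect e u v.

Definition is_tree : Prop := [/\ simple_graph, connected_graph & acyclic].

Definition degree (v : T) : nat := #|[set w | e v w]|.

Definition leaf (v : T) : bool := degree v == 1.

(* The subgraph induced by [S] is a (possibly empty) path graph: the vertices
   of [S] can be listed so that two of them are adjacent exactly when they are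
   consecutive in the list. *)
Definition induces_path (S : {set T}) : Prop :=
  exists s : seq T,
    [/\ uniq s, s =i S &
        {in s &, forall u v, e u v = (index v s == (index u s).+1)
                                  || (index u s == (index v s).+1)}].

Definition caterpillar : Prop :=
  is_tree /\ induces_path [set v | ~~ leaf v].

(* Positions are 0-based: ['I_#|T|] stands for {1, ..., n}; only differences of
   positions matter. *)
Definition linear_arrangement (pi : {ffun T -> 'I_#|T|}) : bool :=
  injectiveb pi && [forall i, exists v, pi v == i].

Definition edge_length (pi : {ffun T -> 'I_#|T|}) (u v : T) : nat :=
  (maxn (pi u) (pi v) - minn (pi u) (pi v))%N.

(* As [pi] is injective, the condition [pi p.1 < pi p.2] selects exactly one of
   the two orientations of each edge. *)
Definition arrangement_cost (pi : {ffun T -> 'I_#|T|}) : nat :=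
  (\sum_(p : T * T | e p.1 p.2 && (pi p.1 < pi p.2)) edge_length pi p.1 p.2)%N.

(* The first argument of [arg min] is only a witness that the range of the
   minimum is nonempty. *)
Definition Dmin : nat :=
  arrangement_cost
    [arg min_(pi < [ffun v => enum_rank v] | linear_arrangement pi)
       arrangement_cost pi].

Definition degree_second_moment : rat :=
  ((\sum_(v : T) (degree v)%:R ^+ 2) / #|T|%:R)%R.

Definition odd_degree_count : nat := (\sum_(v : T) degree v %% 2)%N.

Lemma odd_degree_countE : odd_degree_count = #|[set v | odd (degree v)]|.
Proof.
rewrite /odd_degree_count -sum1dep_card [RHS]big_mkcond /=.
by apply: eq_bigr => v _; rewrite modn2; case: odd.
Qed.

Lemma enum_rank_arrangement : linear_arrangement [ffun v => enum_rank v].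
Proof.
apply/andP; split.
  by apply/injectiveP => u v; rewrite !ffunE => /enum_rank_inj.
apply/forallP => i; apply/existsP; exists (enum_val i).
by rewrite ffunE enum_valK.
Qed.

Lemma Dmin_attained :
  exists2 pi, linear_arrangement pi & Dmin = arrangement_cost pi.
Proof.
rewrite /Dmin; case: arg_minnP => [|pi api _]; first exact: enum_rank_arrangement.
by exists pi.
Qed.

Lemma Dmin_le pi : linear_arrangement pi -> Dmin <= arrangement_cost pi.
Proof.
rewrite /Dmin; case: arg_minnP => [|rho _ min_rho]; first exact: enum_rank_arrangement.
exact: min_rho.
Qed.

End Graphs.

(* Main.v *)
(* The length of an edge is one plus the number of vertices strictly below it.
   If [v] has [a] neighbours on its left and [b] on its right, the edges at [v]
   pass over neighbours of [v] exactly ['C(a, 2) + 'C(b, 2)] times, which is at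
   least [floor ((k - 1)^2 / 4)] for [k = a + b], with equality when [a] and [b]
   differ by at most one. A tree has no triangles, so no (edge, vertex) pair is
   counted from both ends of the edge: this gives the lower bound. It is attained
   by laying out the backbone in order and splitting the leaves of each backbone
   vertex around it so that its neighbours are balanced: every vertex below an
   edge is then adjacent to one of its ends. *)
Require Import Defs.
From mathcomp Require Import all_boot all_order all_algebra.
From mathcomp Require Import zify ring lra.

Set Implicit Arguments.
Unset Strict Implicit.
Unset Printing Implicit Defensive.

Import Order.TTheory GRing.Theory Num.Theory.

(** * Counting ordered pairs inside a finite set *)

Lemma card_set_sum (T : finType) (P : pred T) : #|[set w | P w]| = \sum_w P w.
Proof. by rewrite -sum1dep_card big_mkcond; apply: eq_bigr => w _; case: (P w). Qed.

(** Each unordered pair of distinct elements of [A] is counted once, at the element with the larger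
    value of [f]. *)
Lemma sum_card_below (T : finType) (f : T -> nat) (A : {set T}) :
  injective f -> \sum_(v in A) #|[set w in A | f w < f v]| = 'C(#|A|, 2).
Proof.
move=> f_inj; set S := LHS.
have SE : S = \sum_(v in A) \sum_(w in A) (f w < f v).
  apply: eq_bigr => v _; rewrite -sum1dep_card big_mkcondr /=.
  by apply: eq_bigr => w _; case: ifP.
have SE' : S = \sum_(v in A) \sum_(w in A) (f v < f w).
  by rewrite SE exchange_big.
(* Pairs below, pairs above and the diagonal together fill the square of [A]. *)
have tot : S + S + #|A| = #|A| * #|A|.
  rewrite {1}SE SE' -sum1_card -big_split -big_split /= big_distrl /=.
  apply: eq_bigr => v vA; rewrite -big_split /= mul1n.
  rewrite (bigD1 v) //= ltnn add0n addnC [RHS](bigD1 v) //=; congr addn.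
  apply: eq_bigr => w /andP[_ wv].
  by have := contra_neq (@f_inj w v) wv; case: ltngtP.
by rewrite bin2 -subn1 mulnBr muln1; lia.
Qed.

Lemma sum_card_above (T : finType) (f : T -> nat) (A : {set T}) :
  injective f -> \sum_(v in A) #|[set w in A | f v < f w]| = 'C(#|A|, 2).
Proof.
move=> f_inj; rewrite -(sum_card_below A f_inj).
under eq_bigr do rewrite -sum1dep_card.
under [RHS]eq_bigr do rewrite -sum1dep_card.
rewrite (exchange_big_dep (mem A)) /=; last by move=> v w _ /andP[].
apply: eq_bigr => v vA; apply: eq_bigl => w.
by rewrite vA.
Qed.

(** * Positions and edge lengths *)

Local Notation pos pi := (fun v => nat_of_ord (pi v)).

Lemma arrangement_inj (T : finType) (pi : {ffun T -> 'I_#|T|}) :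
  linear_arrangement pi -> injective (pos pi).
Proof. by case/andP=> /injectiveP pi_inj _ u v /val_inj /pi_inj. Qed.

Lemma card_arrangement_below (T : finType) (pi : {ffun T -> 'I_#|T|}) (v : T) :
  linear_arrangement pi -> #|[set w | pi w < pi v]| = pi v.
Proof.
case/andP=> /injectiveP pi_inj _.
have pi_bij : bijective pi by apply: inj_card_bij => //; rewrite card_ord.
have -> : [set w | pi w < pi v] = pi @^-1: [set i : 'I_#|T| | i < pi v].
  by apply/setP => w; rewrite !inE.
rewrite on_card_preimset; last exact: onW_bij.
by rewrite -sum1dep_card -(big_ord_widen _ (fun=> 1) (ltnW (ltn_ord _))) sum1_card card_ord.
Qed.

Lemma edge_lengthE (T : finType) (pi : {ffun T -> 'I_#|T|}) (u v : T) :
  linear_arrangement pi -> pi u < pi v ->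
  edge_length pi u v = 1 + #|[set w | pi u < pi w < pi v]|.
Proof.
move=> pi_arr uv; have /andP[/injectiveP pi_inj _] := pi_arr.
have := card_arrangement_below v pi_arr; have := card_arrangement_below u pi_arr.
(* The vertices below [v] are [u], those below [u] and those strictly between; comparing cardinals
   gives the length. *)
have -> : [set w | pi w < pi v] =
  u |: ([set w | pi w < pi u] :|: [set w | pi u < pi w < pi v]).
  apply/setP => w; rewrite !inE; case: (eqVneq w u) => [->|wu] /=; first exact: uv.
  have : pi w <> pi u :> nat by move/val_inj/pi_inj/eqP; rewrite (negPf wu).
  by move: uv; move: (pi u : nat) (pi v : nat) (pi w : nat); lia.
rewrite cardsU1 !inE ltnn /= cardsU.
have -> : [set w | pi w < pi u] :&: [set w | pi u < pi w < pi v] = set0.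
  by apply/setP => w; rewrite !inE; lia.
by rewrite cards0 /edge_length; move: uv; move: (pi u : nat) (pi v : nat); lia.
Qed.

(** * Neighbours on either side and sums over edges *)

Definition left_nbrs (T : finType) (e : rel T) (f : T -> nat) (v : T) : {set T} :=
  [set w | e v w && (f w < f v)].

Definition right_nbrs (T : finType) (e : rel T) (f : T -> nat) (v : T) : {set T} :=
  [set w | e v w && (f v < f w)].

Lemma card_left_right_nbrs (T : finType) (e : rel T) (f : T -> nat) (v : T) :
  irreflexive e -> injective f ->
  #|left_nbrs e f v| + #|right_nbrs e f v| = degree e v.
Proof.
move=> e_irr f_inj; rewrite /degree -cardsUI.
have -> : left_nbrs e f v :&: right_nbrs e f v = set0.
  by apply/setP => w; rewrite !inE; lia.
rewrite cards0 addn0; congr #|pred_of_set _|; apply/setP => w; rewrite !inE.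
case: (eqVneq w v) => [->|wv]; first by rewrite e_irr.
by have := contra_neq (@f_inj w v) wv; lia.
Qed.

Lemma sum_edges_right (T : finType) (e : rel T) (f : T -> nat) (F : T -> T -> nat) :
  \sum_(p : T * T | e p.1 p.2 && (f p.1 < f p.2)) F p.1 p.2 =
  \sum_v \sum_(w in right_nbrs e f v) F v w.
Proof.
rewrite pair_big_dep /=; apply: eq_bigl => p; by rewrite inE.
Qed.

Lemma sum_edges_left (T : finType) (e : rel T) (f : T -> nat) (F : T -> T -> nat) :
  symmetric e ->
  \sum_(p : T * T | e p.1 p.2 && (f p.1 < f p.2)) F p.1 p.2 =
  \sum_v \sum_(w in left_nbrs e f v) F w v.
Proof.
move=> e_sym; rewrite sum_edges_right (exchange_big_dep xpredT) //=.
by apply: eq_bigr => v _; apply: eq_bigl => w; rewrite !inE e_sym.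
Qed.

(** Handshake: each edge is met once from its left end and once from its right end. *)
Lemma sum_degree (T : finType) (e : rel T) (f : T -> nat) :
  simple_graph e -> injective f ->
  \sum_v degree e v = (\sum_(p : T * T | e p.1 p.2 && (f p.1 < f p.2)) 1).*2.
Proof.
move=> [e_sym e_irr] f_inj.
rewrite -addnn {1}(sum_edges_left _ (fun _ _ => 1)) //.
rewrite (sum_edges_right _ _ (fun _ _ => 1)) -big_split /=.
by apply: eq_bigr => v _; rewrite !sum1_card card_left_right_nbrs.
Qed.

(** * The exact cost of an arrangement *)

Definition triangle_free (T : finType) (e : rel T) : Prop :=
  forall u v w, e u v -> e u w -> e v w -> False.

(* A vertex below an edge [uv] is adjacent to [u], to [v] or to neither; absence
   of triangles makes the first two cases exclusive, and counting them by the
   common neighbour gives the binomial terms. *)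
Lemma arrangement_costE (T : finType) (e : rel T) (pi : {ffun T -> 'I_#|T|}) :
  simple_graph e -> triangle_free e -> linear_arrangement pi ->
  arrangement_cost e pi =
    \sum_(p : T * T | e p.1 p.2 && (pi p.1 < pi p.2)) 1 +
    \sum_v ('C(#|left_nbrs e (pos pi) v|, 2) + 'C(#|right_nbrs e (pos pi) v|, 2)) +
    \sum_(p : T * T | e p.1 p.2 && (pi p.1 < pi p.2))
      #|[set w | [&& pi p.1 < pi w < pi p.2, ~~ e p.1 w & ~~ e p.2 w]]|.
Proof.
move=> [e_sym e_irr] e_tf pi_arr; have f_inj := arrangement_inj pi_arr.
have right : \sum_(p : T * T | e p.1 p.2 && (pi p.1 < pi p.2))
    #|[set w | (pi p.1 < pi w < pi p.2) && e p.1 w]| =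
    \sum_v 'C(#|right_nbrs e (pos pi) v|, 2).
  rewrite (sum_edges_right _ (pos pi) (fun u v => #|[set w | (pi u < pi w < pi v) && e u w]|)).
  (* For a fixed left end [u], the vertices [w] and [v] are two right neighbours of [u] with [w]
     below [v]. *)
  apply: eq_bigr => u _; rewrite -(sum_card_below _ f_inj).
  apply: eq_bigr => v _; congr #|pred_of_set _|; apply/setP => w; rewrite !inE; lia.
have left : \sum_(p : T * T | e p.1 p.2 && (pi p.1 < pi p.2))
    #|[set w | (pi p.1 < pi w < pi p.2) && e p.2 w]| =
    \sum_v 'C(#|left_nbrs e (pos pi) v|, 2).
  rewrite (sum_edges_left (pos pi) (fun u v => #|[set w | (pi u < pi w < pi v) && e v w]|)) //.
  apply: eq_bigr => u _; rewrite -(sum_card_above _ f_inj).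
  apply: eq_bigr => v _; congr #|pred_of_set _|; apply/setP => w; rewrite !inE; lia.
rewrite big_split /= -left -right addnA -!big_split /=.
apply: eq_bigr => -[u v] /= /andP[uv ltuv].
rewrite edge_lengthE // -!addnA; congr (_ + _).
have tf w : ~~ (e u w && e v w) by apply/negP => /andP[uw vw]; exact: (e_tf u v w).
rewrite !card_set_sum -!big_split /=; apply: eq_bigr => w _.
by move: (tf w); case: (e u w); case: (e v w); case: (_ < _ < _).
Qed.

(** * Balanced sums of binomials *)

Lemma bin2_double (k : nat) : 'C(k, 2).*2 + k = k * k.
Proof. by elim: k => // k IH; rewrite binS bin1; nia. Qed.

(** The product [k./2 * k.-1./2] is floor((k - 1)^2 / 4). By convexity, the binomial sum for fixed
    [a + b] is least at the even split. *)
Lemma leq_balanced_bin (a b : nat) :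
  (a + b)./2 * (a + b).-1./2 <= 'C(a, 2) + 'C(b, 2).
Proof.
have := bin2_double a; have := bin2_double b; set x := 'C(a, 2); set y := 'C(b, 2).
have [[h kE]|[h kE]] : (exists h, a + b = h.*2) \/ (exists h, a + b = h.*2.+1).
- by case: (boolP (odd (a + b))) => ?; [right|left]; exists (a + b)./2; lia.
- have -> : (a + b)./2 = h by lia.
  have -> : (a + b).-1./2 = h.-1 by lia.
  have -> : b = h.*2 - a by lia.
  by case: (leqP a h); nia.
- have -> : (a + b)./2 = h by lia.
  have -> : (a + b).-1./2 = h by lia.
  have -> : b = h.*2.+1 - a by lia.
  by case: (leqP a h); nia.
Qed.

(** If either part is the rounded-down half, the two parts differ by at most one. *)
Lemma balanced_bin (a b : nat) : a = (a + b)./2 \/ b = (a + b)./2 ->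
  'C(a, 2) + 'C(b, 2) = (a + b)./2 * (a + b).-1./2.
Proof.
wlog: a b / a <= b => [ab|ab h].
  case: (leqP a b) => [|/ltnW] ba h; first exact: ab.
  by rewrite addnC [a + b]addnC ab // addnC or_comm.
have [bE | bE] : b = a \/ b = a.+1 by lia.
  rewrite bE; have := bin2_double a; case: a {ab h bE} => // a; move: 'C(_, _) => x aE.
  have -> : (a.+1 + a.+1)./2 = a.+1 by lia.
  have -> : (a.+1 + a.+1).-1./2 = a by lia.
  nia.
rewrite bE; have := bin2_double a; rewrite binS bin1; move: 'C(_, _) => x aE.
have -> : (a + a.+1)./2 = a by lia.
have -> : (a + a.+1).-1./2 = a by lia.
lia.
Qed.

(** * Arrangements prescribed by a key *)

(** Sorting by [key] leaves the order of ties unspecified, so only strict inequalities are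
    transferred. *)
Lemma exists_arrangement_of_key (T : finType) (key : T -> nat) :
  exists2 pi : {ffun T -> 'I_#|T|}, linear_arrangement pi &
    forall u v, key u < key v -> pi u < pi v.
Proof.
pose s := sort (relpre key leq) (enum T).
have mem_s v : v \in s by rewrite mem_sort mem_enum.
have s_size : size s = #|T| by rewrite size_sort -cardE.
have lt_index v : index v s < #|T| by rewrite -s_size index_mem.
pose pi := [ffun v => Ordinal (lt_index v)].
have pi_inj : injective pi.
  by move=> u v /(congr1 val); rewrite !ffunE /= => /index_inj; apply.
exists pi.
  apply/andP; split; first exact/injectiveP.
  have [g _ piK] : bijective pi by apply: inj_card_bij => //; rewrite card_ord.
  by apply/forallP => i; apply/existsP; exists (g i); rewrite piK.
move=> u v; rewrite !ffunE /=; apply: contraTT; rewrite -!leqNgt.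
apply: (@sorted_leq_index _ (relpre key leq)) => //.
- by move=> x y z /= /leq_trans; apply.
- by move=> x /=.
- by apply: sort_sorted => x y; exact: leq_total.
Qed.

(** * Triangles and leaves in trees *)

Lemma tree_triangle_free (T : finType) (e : rel T) :
  is_tree e -> triangle_free e.
Proof.
move=> [[e_sym e_irr] _ e_acyc] u v w uv uw vw.
apply: (e_acyc [:: u; v; w]) => //; apply/andP; split => /=.
  by rewrite uv vw e_sym uw.
rewrite !inE negb_or !andbT; apply/andP; split; first (apply/andP; split);
  by apply/eqP => E; subst; rewrite e_irr in uv uw vw.
Qed.

Lemma leaf_nbr_unique (T : finType) (e : rel T) (x y z : T) :
  leaf e x -> e x y -> e x z -> y = z.
Proof.
move=> /eqP /esym deg1 xy xz.
have /card_le1_eqP : #|[set w | e x w]| <= 1 by rewrite -/(degree e x) -deg1.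
by apply; rewrite inE.
Qed.

(** Two adjacent leaves form a set closed under adjacency, which by connectedness is everything. *)
Lemma leaf_edge_spans (T : finType) (e : rel T) (x y : T) :
  symmetric e -> connected_graph e -> leaf e x -> leaf e y -> e x y ->
  [set: T] = [set x; y].
Proof.
move=> e_sym [_ e_con] lx ly xy; apply/setP => w; rewrite inE.
have cl : closed e (mem [set x; y]).
  apply: (intro_closed (sym_connect_sym e_sym)) => u v uv; rewrite !inE.
  case/orP => /eqP uE; subst u.
    by rewrite (leaf_nbr_unique lx uv xy) eqxx orbT.
  by rewrite (leaf_nbr_unique ly uv (etrans (e_sym y x) xy)) eqxx.
by rewrite -(closed_connect cl (e_con x w)) !inE eqxx.
Qed.

(** For a leaf this is its only neighbour; the default [x] merely makes the function total. *)
Definition some_nbr (T : finType) (e : rel T) (x : T) : T :=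
  odflt x [pick y | e x y].

Lemma some_nbr_leaf (T : finType) (e : rel T) (x y : T) :
  leaf e x -> e x y -> some_nbr e x = y.
Proof.
move=> lx xy; rewrite /some_nbr; case: pickP => [z xz|/(_ y)] /=.
  exact: leaf_nbr_unique lx xz xy.
by rewrite xy.
Qed.

Lemma leaf_some_nbr (T : finType) (e : rel T) (x : T) :
  leaf e x -> e x (some_nbr e x).
Proof.
move=> /eqP dx; rewrite /some_nbr; case: pickP => //= no.
have : #|[set w | e x w]| = 0 by apply: eq_card0 => w; rewrite inE no.
by rewrite -/(degree e x) dx.
Qed.

(** * The balanced arrangement of a caterpillar *)

Lemma index_eq_inj (T : eqType) (s : seq T) (x y : T) :
  y \in s -> index x s = index y s -> x = y.
Proof.
move=> ys xy; have xs : x \in s by rewrite -index_mem xy index_mem.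
exact: index_inj xs ys xy.
Qed.

(* Blocks of backbone vertices are laid out in the order of the backbone; the
   block of [v] is: some leaves of [v], then [v], then its other leaves, so that
   together with the backbone neighbours half of the neighbours lie on each side. *)
Lemma caterpillar_arrangement (T : finType) (e : rel T) :
  caterpillar e ->
  exists2 pi : {ffun T -> 'I_#|T|}, linear_arrangement pi &
    (forall u v w, e u v -> pi u < pi w < pi v -> e u w || e v w) /\
    (forall v, #|left_nbrs e (pos pi) v| = (degree e v)./2 \/
               #|right_nbrs e (pos pi) v| = (degree e v)./2).
Proof.
move=> [[[e_sym e_irr] e_con _] [s [s_uniq s_mem s_adj]]].
pose rank x := index x s.
have memP x : (x \in s) = ~~ leaf e x by rewrite s_mem inE.
(* [P v] and [X v] hold the backbone neighbours before and after [v], [L v] its leaves; [lft v]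
   selects the leaves that bring the left side up to half the degree. *)
pose P v := [set x | [&& e v x, ~~ leaf e x & rank x < rank v]].
pose X v := [set x | [&& e v x, ~~ leaf e x & rank v < rank x]].
pose L v := [set x | e v x && leaf e x].
pose lft v := take ((degree e v)./2 - #|P v|) (enum (L v)).
pose block x := rank (if leaf e x then some_nbr e x else x).
pose side x := if leaf e x then (x \notin lft (some_nbr e x)).*2 else 1.
(* Base 3 encodes lexicographic order: block first, then left leaves (0), backbone vertex (1), right
   leaves (2). *)
pose key x := 3 * block x + side x.
have [pi pi_arr pi_key] := exists_arrangement_of_key key.
have f_inj := arrangement_inj pi_arr.
have key_le u v : pi u < pi v -> key u <= key v.
  apply: contraTT; rewrite -ltnNge -leqNgt => /pi_key; exact: ltnW.
have block_le u v : pi u < pi v -> block u <= block v.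
  have side_lt x : side x < 3 by rewrite /side; case: ifP => _ //; case: (_ \notin _).
  move=> /key_le; rewrite /key; move: (side_lt u) (side_lt v).
  by move: (block u) (block v) (side u) (side v); clear; lia.
have block_adj x w : x \in s -> w != x -> block w = rank x -> e x w.
  move=> xs wx /(index_eq_inj xs); case: ifP => [lw <-|_ wE].
    by rewrite e_sym leaf_some_nbr.
  by rewrite wE eqxx in wx.
have adj u v : ~~ leaf e u -> ~~ leaf e v -> e u v ->
    rank v = (rank u).+1 \/ rank u = (rank v).+1.
  rewrite -!memP => us vs; rewrite s_adj // => /orP[] /eqP; by [left|right].
exists pi => //; split=> [u v w uv /andP[uw wv]|v].
  have vu : e v u by rewrite e_sym.
  have wNu : w != u by apply: contraTneq uw => ->; rewrite ltnn.
  have wNv : w != v by apply: contraTneq wv => ->; rewrite ltnn.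
  have := block_le _ _ uw; have := block_le _ _ wv; rewrite {2 3}/block.
  (* Two adjacent leaves leave no room for [w]; a leaf and its neighbour share a block; adjacent
     backbone vertices own consecutive blocks. So [w] lies in the block of a backbone end of the
     edge. *)
  case: (boolP (leaf e u)) => lu; case: (boolP (leaf e v)) => lv.
  - have := in_setT w; rewrite (leaf_edge_spans e_sym e_con lu lv uv) !inE.
    by rewrite (negPf wNu) (negPf wNv).
  - rewrite (some_nbr_leaf lu uv) => le1 le2.
    by rewrite (block_adj v) ?orbT ?memP //; apply/eqP; rewrite eqn_leq le1.
  - rewrite (some_nbr_leaf lv vu) => le1 le2.
    by rewrite (block_adj u) ?memP //; apply/eqP; rewrite eqn_leq le1.
  - move=> le1 le2.
    have [E|E] : block w = rank u \/ block w = rank v.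
      by move: (adj _ _ lu lv uv) le1 le2; move: (block w) (rank u) (rank v); clear; lia.
    + by rewrite (block_adj u) ?memP.
    + by rewrite (block_adj v) ?orbT ?memP.
have lr := card_left_right_nbrs v e_irr f_inj.
case: (boolP (leaf e v)) => lv.
  (* A leaf has a single neighbour, so one of its sides is empty, and half of 1 is 0. *)
  by move/eqP: (lv) lr => ->; move: #|left_nbrs _ _ _| #|right_nbrs _ _ _|; clear; lia.
left.
have cP : #|P v| <= 1.
  apply/card_le1_eqP => x y; rewrite !inE => /and3P[vx lx rx] /and3P[vy ly ry].
  apply: (@index_eq_inj _ s); rewrite ?memP //.
  move: (adj _ _ lv lx vx) (adj _ _ lv ly vy) rx ry; rewrite -!/(rank _).
  by move: (rank x) (rank y) (rank v); clear; lia.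
have cX : #|X v| <= 1.
  apply/card_le1_eqP => x y; rewrite !inE => /and3P[vx lx rx] /and3P[vy ly ry].
  apply: (@index_eq_inj _ s); rewrite ?memP //.
  move: (adj _ _ lv lx vx) (adj _ _ lv ly vy) rx ry; rewrite -!/(rank _).
  by move: (rank x) (rank y) (rank v); clear; lia.
have cd : degree e v = #|P v| + #|L v| + #|X v|.
  rewrite /degree !card_set_sum -!big_split /=; apply: eq_bigr => x _.
  case: (boolP (e v x)) => //= vx; case: (boolP (leaf e x)) => //= lx.
  by move: (adj _ _ lv lx vx); move: (rank x) (rank v); clear; lia.
have leftE : left_nbrs e (pos pi) v = P v :|: [set x in lft v].
  apply/setP => x; rewrite !inE.
  have lftL : x \in lft v -> e v x && leaf e x.
    by move/mem_take; rewrite mem_enum inE.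
  case: (boolP (e v x)) lftL => [vx|_ /contraNF -> //] /=.
  have pi_lt : key x != key v -> (pi x < pi v) = (key x < key v).
    move=> ne; apply/idP/idP => [/key_le|]; [by rewrite ltn_neqAle ne | exact: pi_key].
  case: (boolP (leaf e x)) => lx lftL /=.
    have xv : e x v by rewrite e_sym.
    have [key_ltE key_neq] : (key x < key v) = (x \in lft v) /\ key x != key v.
      rewrite /key /block /side lx (negPf lv) (some_nbr_leaf lx xv) ltn_add2l eqn_add2l.
      by case: (_ \in _).
    by rewrite pi_lt ?key_ltE.
  rewrite (contraNF lftL isT) orbF.
  have key_nonleaf y : ~~ leaf e y -> key y = 3 * rank y + 1.
    by rewrite /key /block /side => /negPf ->.
  rewrite pi_lt !key_nonleaf //; move: (adj _ _ lv lx vx);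
    by move: (rank x) (rank v); clear; lia.
rewrite leftE cardsU.
have -> : P v :&: [set x in lft v] = set0.
  apply/setP => x; rewrite !inE; apply/negP => /andP[/and3P[_ lx _] /mem_take].
  by rewrite mem_enum inE (negPf lx) andbF.
have : #|[set x in lft v]| = size (lft v).
  rewrite cardsE; apply/card_uniqP; exact: take_uniq (enum_uniq _).
rewrite size_take_min -cardE cards0 => ->.
(* As the degree is not 1, its half is at least [#|P v|], so the truncated subtraction is exact;
   [#|X v| <= 1] ensures that there are enough leaves to take. *)
by move: lv cP cX; rewrite /leaf cd; move: #|P v| #|L v| #|X v|; clear; lia.
Qed.

(** * The number of edges of a caterpillar *)

(** Place all leaves first, then the backbone in order. Every vertex but the last has exactly one
    right neighbour: a leaf its backbone vertex, a backbone vertex its successor. This gives n - 1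
    edges. *)
Lemma caterpillar_sum_degree (T : finType) (e : rel T) :
  caterpillar e -> \sum_v degree e v = (#|T|.-1).*2.
Proof.
move=> [[[e_sym e_irr] e_con _] [s [s_uniq s_mem s_adj]]].
have memP x : (x \in s) = ~~ leaf e x by rewrite s_mem inE.
(* A tree consisting of one edge has an empty backbone and is treated apart. *)
case: (boolP [exists x, exists y, [&& leaf e x, leaf e y & e x y]]).
  case/existsP => x /existsP[y /and3P[lx ly xy]].
  have TE := leaf_edge_spans e_sym e_con lx ly xy.
  have xNy : x != y by apply: contraTneq xy => ->; rewrite e_irr.
  rewrite -cardsT TE cards2 xNy.
  have deg1 v : degree e v = 1.
    by have := in_setT v; rewrite TE !inE => /orP[] /eqP ->; exact/eqP.
  under eq_bigr do rewrite deg1.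
  by rewrite sum1_card -cardsT TE cards2 xNy.
move=> no_ll.
have nbr_nonleaf x y : leaf e x -> e x y -> ~~ leaf e y.
  move=> lx xy; apply: contra no_ll => ly; apply/existsP; exists x.
  by apply/existsP; exists y; rewrite lx ly.
have [x0 x0s] : exists x0, x0 \in s.
  have /card_gt0P[x _] := e_con.1; case: (boolP (leaf e x)) => lx.
    exists (some_nbr e x); rewrite memP.
    exact: nbr_nonleaf lx (leaf_some_nbr lx).
  by exists x; rewrite memP.
pose z := last x0 s.
have s_pos : 0 < size s by case: (s) x0s.
have zE : z = nth x0 s (size s).-1 by rewrite nth_last.
have zs : z \in s by rewrite zE mem_nth // prednK.
have rz : index z s = (size s).-1 by rewrite zE index_uniq // prednK.
(* Backbone indices are shifted by one to leave 0 to the leaves. *)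
pose key x := if leaf e x then 0 else (index x s).+1.
have [pi pi_arr pi_key] := exists_arrangement_of_key key.
have f_inj := arrangement_inj pi_arr.
have key_le u v : pi u < pi v -> key u <= key v.
  apply: contraTT; rewrite -ltnNge -leqNgt => /pi_key; exact: ltnW.
rewrite (sum_degree (conj e_sym e_irr) f_inj); congr double.
rewrite (sum_edges_right _ (pos pi) (fun _ _ => 1)).
transitivity #|predC1 z|; last exact: cardC1.
rewrite -[RHS]sum1_card [RHS]big_mkcond /=.
apply: eq_bigr => x _; rewrite sum1_card inE.
have pi_lt y : key x != key y -> (pi x < pi y) = (key x < key y).
  move=> ne; apply/idP/idP => [/key_le|]; [by rewrite ltn_neqAle ne | exact: pi_key].
case: (boolP (leaf e x)) => lx.
  have -> : x != z by apply: contraTneq zs => <-; rewrite memP lx.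
  rewrite -(eqP lx); congr #|pred_of_set _|; apply/setP => y; rewrite !inE.
  case: (boolP (e x y)) => //= xy; have ly := nbr_nonleaf _ _ lx xy.
  by rewrite pi_lt /key lx (negPf ly).
have xs : x \in s by rewrite memP.
have right_succ y : (y \in right_nbrs e (pos pi) x) = (y \in s) && (index y s == (index x s).+1).
  rewrite inE; case: (boolP (y \in s)) => [ys|] /=.
    have ly : ~~ leaf e y by rewrite -memP.
    rewrite s_adj //; case: (eqVneq (index y s) (index x s)) => [E|N].
      rewrite E; have -> : x = y by exact: index_eq_inj (esym E).
      by rewrite ltnn andbF eqn_leq ltnn andbF.
    rewrite pi_lt /key (negPf lx) (negPf ly) ?eqSS 1?eq_sym //.
    by move: N; move: (index _ _) (index _ _); clear; lia.
  rewrite memP negbK => ly.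
  have /pi_key : key y < key x by rewrite /key (negPf lx) ly.
  by move=> /ltnW; rewrite leqNgt => /negPf ->; rewrite andbF.
case: eqVneq => [xz|xNz].
  apply: eq_card0 => y; rewrite right_succ; apply/negP => /andP[].
  by rewrite -index_mem xz rz => lt_y /eqP yE; rewrite yE prednK // ltnn in lt_y.
have xlt : (index x s).+1 < size s.
  have : index x s <> index z s by move/(index_eq_inj zs)/eqP; rewrite (negPf xNz).
  by rewrite rz; move: xs; rewrite -index_mem; move: (index _ _) (size s); clear; lia.
rewrite -(cards1 (nth x0 s (index x s).+1)); apply: eq_card => y.
rewrite right_succ inE; apply/andP/eqP => [[ys /eqP <-]|->].
  by rewrite nth_index.
by rewrite mem_nth // index_uniq.
Qed.

(** * The minimum in terms of degrees *)

Lemma caterpillar_Dmin (T : finType) (e : rel T) :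
  caterpillar e ->
  Dmin e = #|T|.-1 + \sum_v (degree e v)./2 * (degree e v).-1./2.
Proof.
move=> cat; have [tree _] := cat; have [simple _ _] := tree.
have tf := tree_triangle_free tree.
have edges pi : linear_arrangement pi ->
    \sum_(p : T * T | e p.1 p.2 && (pi p.1 < pi p.2)) 1 = #|T|.-1.
  move=> /arrangement_inj f_inj; apply: double_inj.
  by rewrite -(sum_degree simple f_inj) caterpillar_sum_degree.
apply/eqP; rewrite eqn_leq; apply/andP; split.
  have [pi pi_arr [pi_cov pi_bal]] := caterpillar_arrangement cat.
  apply: leq_trans (Dmin_le e pi_arr) _.
  (* Upper bound: the third sum vanishes by [pi_cov], and balance makes the binomial terms
     minimal. *)
  rewrite arrangement_costE // edges // [X in _ + X]big1 ?addn0.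
    rewrite leq_add2l; apply: leq_sum => v _.
    rewrite -(card_left_right_nbrs v simple.2 (arrangement_inj pi_arr)) balanced_bin //.
    by rewrite (card_left_right_nbrs v simple.2 (arrangement_inj pi_arr)).
  move=> [u v] /= /andP[uv _]; apply: eq_card0 => w; rewrite inE.
  by apply/negP => /and3P[/(pi_cov _ _ _ uv) /orP[->|->]].
have [pi pi_arr ->] := Dmin_attained e.
(* Lower bound: the third sum is bounded below by 0, the binomials vertex by vertex. *)
rewrite arrangement_costE // edges // -[leqLHS]addn0 leq_add // leq_add2l.
apply: leq_sum => v _; rewrite -(card_left_right_nbrs v simple.2 (arrangement_inj pi_arr)).
exact: leq_balanced_bin.
Qed.

(** * Floors and the three closed forms *)

Local Open Scope ring_scope.

Lemma half_mul_half_pred (k : nat) :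
  4 * (k./2 * k.-1./2)%N%:R + 2 * k%:R = k%:R ^+ 2 + (k %% 2)%N%:R :> rat.
Proof.
rewrite -!natrM -natrX -!natrD; congr (_%:R).
have [[h ->]|[[|h] ->]] : (exists h, k = h.*2.+1) \/ (exists h, k = h.*2).
- by case: (boolP (odd k)) => ?; [left|right]; exists k./2; lia.
- have -> : h.*2.+1./2 = h by lia.
  have -> : h.*2.+1.-1./2 = h by lia.
  have -> : (h.*2.+1 %% 2 = 1)%N by lia.
  by nia.
- by [].
- have -> : h.+1.*2./2 = h.+1 by lia.
  have -> : h.+1.*2.-1./2 = h by lia.
  have -> : (h.+1.*2 %% 2 = 0)%N by lia.
  by nia.
Qed.

(** The quarter square exceeds the product by (1 - k mod 2) / 4, which lies in [0, 1). *)
Lemma floor_quarter_sqr_pred (k : nat) :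
  Num.floor (1 / 4 * (k%:R - 1) ^+ 2 : rat) = (k./2 * k.-1./2)%N%:Z.
Proof.
apply: floor_def; rewrite intrD -pmulrn; have := half_mul_half_pred k.
have : (k %% 2)%N%:R <= 1 :> rat by rewrite (ler_nat _ _ 1) -ltnS ltn_mod.
have := ler0n rat (k %% 2).
rewrite sqrrB mulr1 expr1n -mulr_natr; move: (k%:R ^+ 2 : rat) => k2 r_ge0 r_le1 kE.
by apply/andP; split; lra.
Qed.

Theorem theorem4 (T : finType) (e : rel T) (n : nat) (hn : #|T| = n)
  (ht : caterpillar e) :
  [/\ (Dmin e)%:R =
        n%:R - 1 +
        \sum_(v : T) (Num.floor (1 / 4 * ((degree e v)%:R - 1) ^+ 2 : rat))%:~R
        :> rat,
      (Dmin e)%:R =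
        \sum_(v : T) (Num.floor (1 / 4 * ((degree e v)%:R + 1) ^+ 2 : rat))%:~R
        - (n%:R - 1)
        :> rat
    & (Dmin e)%:R =
        1 / 4 * (n%:R * degree_second_moment e + (odd_degree_count e)%:R)
        :> rat].
Proof.
have n_gt0 : (0 < n)%N by have [[_ [T_gt0 _] _] _] := ht; rewrite -hn.
have predn : n.-1%:R = n%:R - 1 :> rat by rewrite -{2}(prednK n_gt0) -natr1 addrK.
have degE : \sum_v (degree e v)%:R = 2 * (n%:R - 1) :> rat.
  by rewrite -natr_sum caterpillar_sum_degree // hn -muln2 natrM predn mulrC.
have DE : (Dmin e)%:R =
    n%:R - 1 + \sum_v ((degree e v)./2 * (degree e v).-1./2)%N%:R :> rat.
  by rewrite caterpillar_Dmin // natrD natr_sum hn predn.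
split.
- by rewrite DE; congr (_ + _); apply: eq_bigr => v _; rewrite floor_quarter_sqr_pred.
- rewrite DE.
  have -> : \sum_v (Num.floor (1 / 4 * ((degree e v)%:R + 1) ^+ 2 : rat))%:~R =
      \sum_v ((degree e v)./2 * (degree e v).-1./2)%N%:R + \sum_v (degree e v)%:R :> rat.
    rewrite -big_split /=; apply: eq_bigr => v _.
    (* The two quarter squares differ by the integer k, which leaves the floor; these shifts add up
       to 2(n - 1). *)
    have -> : 1 / 4 * ((degree e v)%:R + 1) ^+ 2 =
        1 / 4 * ((degree e v)%:R - 1) ^+ 2 + (degree e v)%:~R :> rat by rewrite -pmulrn; field.
    by rewrite floorDrz ?intr_int // floor_quarter_sqr_pred intrD intrKfloor.
  by rewrite degE; ring.
rewrite DE; have n_neq0 : n%:R != 0 :> rat by rewrite pnatr_eq0 -lt0n.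
have -> : n%:R * degree_second_moment e = \sum_v (degree e v)%:R ^+ 2.
  by rewrite /degree_second_moment hn mulrC divfK.
(* Writing n - 1 as half the degree sum turns the third form into an identity for each vertex. *)
have -> : (n%:R - 1 : rat) = 1 / 2 * \sum_v (degree e v)%:R by rewrite degE; field.
rewrite /odd_degree_count natr_sum -big_split /= !mulr_sumr -big_split /=.
apply: eq_bigr => v _; move: (degree e v) => k.
by have := half_mul_half_pred k; lra.
Qed.
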